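(* There exists a two-player zero-sum differentiable game ($L^1=-L^2$) with parameters $\theta=(x,y)\in\mathbb{R}\times\mathbb{R}$, with analytic losses, which is weakly-coercive and nondegenerate and whose only critical point is a strict maximum, such that each of the algorithms GD, AGD, EG, OMD, SGA, CO, CGD, LA, LOLA and SOS (defined below) has, for learning rate $\alpha$ (and, for CO, hyperparameter $\gamma$) sufficiently small, bounded but non-convergent iterates almost surely when $\theta_0$ is drawn from a distribution with bounded support that is absolutely continuous with respect to Lebesgue measure.
   Context: For a two-player game with scalar parameters $\theta=(x,y)$ and losses $L^1,L^2$: the simultaneous gradient is $\xi=(\partial_xL^1,\partial_yL^2)$, the Hessian is $H=\nabla\xi$, $A=(H-H^\top)/2$, $H_o$ is the off-diagonal part of $H$ (diagonal entries set to $0$), and $\nabla L$ is the $2\times 2$ matrix whose $j$-th column is the full gradient $\nabla L^j$. A critical point is $\bar\theta$ with $\xi(\bar\theta)=0$; it is a strict maximum if $u^\top H(\bar\theta)u<0$ for all $u\ne0$. The game is nondegenerate if $H$ is invertible at every critical point, and weakly-coercive if $L^1(x,y)\to\infty$ as $|x|\to\infty$ for each fixed $y$ and $L^2(x,y)\to\infty$ as $|y|\to\infty$ for each fixed $x$. Each algorithm iterates $\theta_{k+1}=\theta_k-\alpha G(\theta_k)$ with: GD $G=\xi$; AGD $G=(\xi_1(x,y),\ \xi_2(x-\alpha\xi_1(x,y),y))$; EG $G=\xi\circ(\mathrm{id}-\alpha\xi)$; OMD $G(\theta_k)=2\xi(\theta_k)-\xi(\theta_{k-1})$, equivalently $G=2\xi-\xi\circ(\mathrm{id}-\alpha\xi)^{-1}$;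 SGA $G=(I+\lambda A^\top)\xi$ with $\lambda=\mathrm{sign}(\langle\xi,H^\top\xi\rangle\langle A^\top\xi,H^\top\xi\rangle)$; CO $G=(I+\gamma H^\top)\xi$; CGD $G=(I+\alpha H_o)^{-1}\xi$; LA $G=(I-\alpha H_o)\xi$; LOLA $G=(I-\alpha H_o)\xi-\alpha\,\mathrm{diag}(H_o^\top\nabla L)$; SOS $G=(I-\alpha H_o)\xi-p\alpha\,\mathrm{diag}(H_o^\top\nabla L)$, where $p\in[0,1]$ is the scalar function of $\theta$ given by the two-part criterion of Stable Opponent Shaping (Letcher et al., 2019), which vanishes at critical points. Here $\mathrm{diag}(M)$ denotes the vector of diagonal entries of $M$. ''Bounded but non-convergent'' means the sequence $(\theta_k)$ is bounded and does not converge. *)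

(* Defs.v *)
From HB Require Import structures.
From mathcomp Require Import all_boot all_order all_algebra.
From mathcomp Require Import all_classical all_reals all_analysis.
Set Implicit Arguments. Unset Strict Implicit. Unset Printing Implicit Defensive.
Import Order.TTheory GRing.Theory Num.Theory.
Import numFieldNormedType.Exports.
Local Open Scope classical_set_scope.
Local Open Scope ring_scope.

Section TwoPlayerGames.
Context {R : realType}.

Definition dx (f : R -> R -> R) : R -> R -> R :=
  fun x y => derive1 (fun t => f t y) x.
Definition dy (f : R -> R -> R) : R -> R -> R :=
  fun x y => derive1 (fun t => f x t) y.

Definition analytic2 (f : R -> R -> R) : Prop :=
  forall a b : R, exists (c : nat -> nat -> R) (r : R), 0 < r /\
    forall x y : R, `|x - a| < r -> `|y - b| < r ->
      (exists M : R, forall n : nat,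
          \sum_(i < n) \sum_(j < n) `|c i j| * `|x - a| ^+ i * `|y - b| ^+ j <= M)
      /\ ((fun n : nat => \sum_(i < n) \sum_(j < n)
              c i j * (x - a) ^+ i * (y - b) ^+ j) @ \oo --> f x y).

Definition vec2 (u v : R) : 'cV[R]_2 :=
  \col_(i < 2) (if val i == 0%N then u else v).
Definition mx2 (a b c d : R) : 'M[R]_2 :=
  \matrix_(i < 2, j < 2)
    (if val i == 0%N then (if val j == 0%N then a else b)
     else (if val j == 0%N then c else d)).
Definition ofpair (p : R * R) : 'cV[R]_2 := vec2 p.1 p.2.
Definition topair (v : 'cV[R]_2) : R * R := (v ord0 ord0, v ord_max ord0).
Definition dotv (u v : 'cV[R]_2) : R := \sum_(i < 2) u i ord0 * v i ord0.
Definition norm2 (u : 'cV[R]_2) : R := dotv u u.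
Definition diagv (M : 'M[R]_2) : 'cV[R]_2 := \col_(i < 2) M i i.
Definition offdiag (M : 'M[R]_2) : 'M[R]_2 :=
  \matrix_(i < 2, j < 2) (if i == j then 0 else M i j).

Variables (L1 L2 : R -> R -> R).

Definition xi (p : R * R) : 'cV[R]_2 :=
  vec2 (dx L1 p.1 p.2) (dy L2 p.1 p.2).
Definition hess (p : R * R) : 'M[R]_2 :=
  mx2 (dx (dx L1) p.1 p.2) (dy (dx L1) p.1 p.2)
      (dx (dy L2) p.1 p.2) (dy (dy L2) p.1 p.2).
Definition antisym (p : R * R) : 'M[R]_2 :=
  (2%:R)^-1 *: (hess p - (hess p)^T).
Definition Ho (p : R * R) : 'M[R]_2 := offdiag (hess p).
Definition gradL (p : R * R) : 'M[R]_2 :=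
  mx2 (dx L1 p.1 p.2) (dx L2 p.1 p.2) (dy L1 p.1 p.2) (dy L2 p.1 p.2).

Definition critical (p : R * R) : Prop := xi p = 0.
Definition strict_max (p : R * R) : Prop :=
  critical p /\ forall u : 'cV[R]_2, u != 0 -> (u^T *m hess p *m u) ord0 ord0 < 0.
Definition nondegenerate_game : Prop := forall p, critical p -> hess p \in unitmx.
Definition weakly_coercive : Prop :=
  (forall y M : R, exists r : R, forall x : R, r < `|x| -> M < L1 x y) /\
  (forall x M : R, exists r : R, forall y : R, r < `|y| -> M < L2 x y).

Inductive algo := GD | AGD | EG | OMD | SGA | CO | CGD | LA | LOLA | SOS.

Definition la_part (alpha : R) (p : R * R) : 'cV[R]_2 :=
  (1%:M - alpha *: Ho p) *m xi p.
Definition chi (p : R * R) : 'cV[R]_2 := diagv ((Ho p)^T *m gradL p).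

(* SOS two-part criterion (Letcher et al. 2019, Algorithm 1),
   hyperparameters a, b in (0,1) *)
Definition sos_p (alpha a b : R) (p : R * R) : R :=
  let xi0 := la_part alpha p in
  let d := dotv ((- alpha) *: chi p) xi0 in
  let p1 := if 0 <= d then 1 else Num.min 1 (- a * norm2 xi0 / d) in
  let p2 := if Num.sqrt (norm2 (xi p)) < b then norm2 (xi p) else 1 in
  Num.min p1 p2.

Definition G (alg : algo) (alpha gamma a b : R) (prev cur : R * R) : 'cV[R]_2 :=
  match alg with
  | GD => xi cur
  | AGD => vec2 (xi cur ord0 ord0)
                (xi (cur.1 - alpha * xi cur ord0 ord0, cur.2) ord_max ord0)
  | EG => xi (topair (ofpair cur - alpha *: xi cur))
  | OMD => 2%:R *: xi cur - xi prev
  | SGA =>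
      let H := hess cur in let A := antisym cur in let v := xi cur in
      let lam := Num.sg (dotv v (H^T *m v) * dotv (A^T *m v) (H^T *m v)) in
      (1%:M + lam *: A^T) *m v
  | CO => (1%:M + gamma *: (hess cur)^T) *m xi cur
  | CGD => invmx (1%:M + alpha *: Ho cur) *m xi cur
  | LA => la_part alpha cur
  | LOLA => la_part alpha cur - alpha *: chi cur
  | SOS => la_part alpha cur - (sos_p alpha a b cur * alpha) *: chi cur
  end.

(* pairs (theta_{k-1}, theta_k), with the convention theta_{-1} := theta_0 *)
Fixpoint iter_pairs (alg : algo) (alpha gamma a b : R) (th0 : R * R) (k : nat)
  : (R * R) * (R * R) :=
  match k with
  | O => (th0, th0)
  | S k' => let pc := iter_pairs alg alpha gamma a b th0 k' in
            (pc.2, topair (ofpair pc.2 - alpha *: G alg alpha gamma a b pc.1 pc.2))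
  end.
Definition iterates (alg : algo) (alpha gamma a b : R) (th0 : R * R) : nat -> R * R :=
  fun k => (iter_pairs alg alpha gamma a b th0 k).2.

End TwoPlayerGames.

Definition bounded_seq {R : realType} (u : nat -> R * R) : Prop :=
  exists M : R, forall k, `|(u k).1| <= M /\ `|(u k).2| <= M.
Definition convergent_seq {R : realType} (u : nat -> R * R) : Prop :=
  exists l : R * R, u @ \oo --> l.
Definition bounded_nonconvergent {R : realType} (u : nat -> R * R) : Prop :=
  bounded_seq u /\ ~ convergent_seq u.

Definition leb2 (R : realType) := (@lebesgue_measure R \x @lebesgue_measure R)%E.
Definition bounded_support {R : realType} (P : probability (R * R)%type R) : Prop :=
  exists M : R, P [set p | `|p.1| <= M /\ `|p.2| <= M] = 1%E.

(* Main.v *)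
Require Import Defs.
From HB Require Import structures.
From mathcomp Require Import all_boot all_order all_algebra.
From mathcomp Require Import all_classical all_reals all_analysis.
From mathcomp Require Import ring lra.
Import Order.TTheory GRing.Theory Num.Theory.
Import numFieldNormedType.Exports.
Local Open Scope classical_set_scope.
Local Open Scope ring_scope.

(** Take [L1 = xy - x^2/2 + y^2/2 + x^4/4 - y^4/4].  For each algorithm, the
    update direction is [xi + lam A^T xi] up to an error of relative size
    [O(alpha + gamma)] on a given disc, with [|lam| <= 1] and [lam <= 0] near
    the origin.  The quartic terms make [-(xi + lam A^T xi)] point inward far
    from the origin, so iterates stay in a disc; near the origin, the unique
    critical point, the strict maximum makes it point outward, so the distance
    to the origin never decreases there.  As [|xi|] is bounded below by
    [|theta| / sqrt 5], a convergent sequence of iterates would tend to the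
    origin, hence would have to be exactly [0] at some step.  A step divides
    the norm by at most [sqrt 2], so this only happens for [theta_0 = 0], which
    is a null event. *)

Definition xi1 {R : realFieldType} (x y : R) : R := y - x + x ^+ 3.
Definition xi2 {R : realFieldType} (x y : R) : R := - x - y + y ^+ 3.
Definition sq {R : realFieldType} (x y : R) : R := x ^+ 2 + y ^+ 2.

(* Since [A^T xi = (- xi2, xi1)], this reads [(g, h) = xi + lam A^T xi + (e, f)];
   [lam] is nonzero only for SGA, and the error [(e, f)] is at most
   [|(x, y)| / 10]. *)
Definition perturbed_field {R : realFieldType} (x y g h : R) : Prop :=
  exists lam e f : R,
    [/\ `|lam| <= 1, sq x y <= 1 / 3 -> lam <= 0,
        sq e f <= sq x y / 100,
        g = xi1 x y - lam * xi2 x y + e & h = xi2 x y + lam * xi1 x y + f].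

(** * Polynomial estimates on the field *)

Section Field.
Context {R : realFieldType}.
Implicit Types (x y e f g h S a : R).

Lemma sq_ge0 x y : 0 <= sq x y.
Proof. by rewrite addr_ge0// sqr_ge0. Qed.

(** In polar coordinates the product is [r^4 sin(4 phi) / 4]. It is the quartic part of the inner
    product of [theta] with [A^T xi], whose quadratic part is [sq x y]. *)
Lemma quartic_le x y : `|x * y * (x ^+ 2 - y ^+ 2)| <= sq x y ^+ 2 / 4.
Proof.
rewrite ler_norml /sq; apply/andP; split.
- have := sqr_ge0 (x ^+ 2 - y ^+ 2 + 2 * (x * y)); lra.
- have := sqr_ge0 (x ^+ 2 - y ^+ 2 - 2 * (x * y)); lra.
Qed.

(** The sum of fourth powers is the quartic part of the inner product of [theta] with [xi], whose
    quadratic part is [- sq x y]. *)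
Lemma pow4_bounds x y : sq x y ^+ 2 / 2 <= x ^+ 4 + y ^+ 4 <= sq x y ^+ 2.
Proof.
rewrite /sq; apply/andP; split.
- have := sqr_ge0 (x ^+ 2 - y ^+ 2); lra.
- have := mulr_ge0 (sqr_ge0 x) (sqr_ge0 y); lra.
Qed.

Lemma xi_upper S x y : sq x y <= S ->
  sq (xi1 x y) (xi2 x y) <= 4 * (1 + S) ^+ 2 * sq x y.
Proof.
move=> sS; have x2 := sqr_ge0 x; have y2 := sqr_ge0 y.
(* Both components have this shape: [(z, w)] is [(x, y)] for [xi1] and [(y, - x)] for [xi2]. *)
have pow z w : z ^+ 2 <= S ->
    (w - z + z ^+ 3) ^+ 2 <= 2 * (1 + S) ^+ 2 * (z ^+ 2 + w ^+ 2).
  move=> zS; have z2 := sqr_ge0 z; have w2 := sqr_ge0 w.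
  have h1 : (z ^+ 2 - 1) ^+ 2 <= (1 + S) ^+ 2 by nra.
  have h2 : 1 <= (1 + S) ^+ 2 by nra.
  have h3 := ler_wpM2l z2 h1; have h4 := ler_wpM2l w2 h2.
  have := sqr_ge0 (w - z * (z ^+ 2 - 1)); lra.
have := pow x y; have := pow y (- x); rewrite /sq /xi1 /xi2 in sS *.
move=> /(_ ltac:(lra)) + /(_ ltac:(lra)).
lra.
Qed.

(* The vector [xi + 2 A^T xi], of norm [sqrt 5 * |xi|], has inner product at
   least [|theta|^2] with [theta]. *)
Lemma xi_lower x y : sq x y <= 5 * sq (xi1 x y) (xi2 x y).
Proof.
have := quartic_le x y; rewrite ler_norml => /andP[q1 _].
have /andP[q2 _] := pow4_bounds x y.
(* The factor 2 makes the quartic bounds cancel: with [s = sq x y],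
   [- s + s^2/2 + 2 (s - s^2/4) = s]. *)
have key : sq x y <= x * (xi1 x y - 2 * xi2 x y) + y * (xi2 x y + 2 * xi1 x y).
  move: q1 q2; rewrite /sq /xi1 /xi2; lra.
have := sqr_ge0 (x - (xi1 x y - 2 * xi2 x y)).
have := sqr_ge0 (y - (xi2 x y + 2 * xi1 x y)).
move: key; rewrite /sq; lra.
Qed.

(** When [z] moves by [w], the polynomial [z^3 - z] changes by [w q], where [q] is at most
    [6 (1 + S)] in absolute value. *)
Lemma xi_lipschitz S x y e f : sq x y <= S -> 0 <= S -> sq e f <= 1 ->
  sq (xi1 (x + e) (y + f) - xi1 x y) (xi2 (x + e) (y + f) - xi2 x y)
    <= 200 * (1 + S) ^+ 2 * sq e f.
Proof.
move=> sS S0 ef1.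
have x2 := sqr_ge0 x; have y2 := sqr_ge0 y.
have e2 := sqr_ge0 e; have f2 := sqr_ge0 f.
have pow z w t : z ^+ 2 <= S -> w ^+ 2 <= 1 ->
    (t - w + ((z + w) ^+ 3 - z ^+ 3)) ^+ 2
      <= 72 * (1 + S) ^+ 2 * w ^+ 2 + 2 * t ^+ 2.
  move=> zS w1; have z2 := sqr_ge0 z; have w2 := sqr_ge0 w.
  set q := 3 * z ^+ 2 + 3 * z * w + w ^+ 2 - 1.
  have -> : t - w + ((z + w) ^+ 3 - z ^+ 3) = t + w * q by rewrite /q; ring.
  have q1 : q <= 6 * (1 + S) by have := sqr_ge0 (z - w); rewrite /q; lra.
  have q2 : - (6 * (1 + S)) <= q by have := sqr_ge0 (z + w); rewrite /q; lra.
  have q3 : q ^+ 2 <= 36 * (1 + S) ^+ 2 by nra.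
  have := ler_wpM2l w2 q3; have := sqr_ge0 (t - w * q); lra.
rewrite /sq in sS ef1.
have h1 := pow x e f ltac:(lra) ltac:(lra).
have h2 := pow y f (- e) ltac:(lra) ltac:(lra).
have -> : xi1 (x + e) (y + f) - xi1 x y = f - e + ((x + e) ^+ 3 - x ^+ 3).
  by rewrite /xi1; ring.
have -> : xi2 (x + e) (y + f) - xi2 x y = - e - f + ((y + f) ^+ 3 - y ^+ 3).
  by rewrite /xi2; ring.
have h3 : 1 <= (1 + S) ^+ 2 by nra.
have h4 := ler_wpM2r e2 h3; have h5 := ler_wpM2r f2 h3.
rewrite /sq; lra.
Qed.

(** * One step along a perturbed field *)

Section Step.
Variables (x y g h : R).
Hypothesis gh : perturbed_field x y g h.

(** As [A^T xi] is [xi] turned by a right angle, [xi + lam A^T xi] has squared norm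
    [(1 + lam^2) |xi|^2], at most [2 |xi|^2]. Adding the error at most doubles this, up to a term
    absorbed in 17 = 16 + 1. *)
Lemma perturbed_field_upper S : 0 <= S -> sq x y <= S ->
  sq g h <= 17 * (1 + S) ^+ 2 * sq x y.
Proof.
case: gh => lam [e [f [lam1 _ ef -> ->]]] S0 sS.
move: lam1; rewrite ler_norml => /andP[l1 l2].
have up := xi_upper _ _ _ sS; have s0 := sq_ge0 x y.
have s1 := sq_ge0 (xi1 x y) (xi2 x y).
have h3 : 1 <= (1 + S) ^+ 2 by nra.
have h4 := ler_wpM2r s0 h3.
have l3 : lam ^+ 2 <= 1 by nra.
have h5 := ler_wpM2r s1 l3.
move: (xi1 x y) (xi2 x y) up h5 s1 => u v up h5 s1.
have := sqr_ge0 (u - lam * v - e); have := sqr_ge0 (v + lam * u - f).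
rewrite /sq in ef up s0 h4 h5 *; lra.
Qed.

(** The orthogonal term [lam A^T xi] cannot shorten [xi], and the error is small against the lower
    bound on [|xi|]. *)
Lemma perturbed_field_lower : sq x y <= 20 * sq g h.
Proof.
case: gh => lam [e [f [_ _ ef -> ->]]].
have lo := xi_lower x y; have s0 := sq_ge0 x y.
have h5 := mulr_ge0 (sqr_ge0 lam) (sq_ge0 (xi1 x y) (xi2 x y)).
move: (xi1 x y) (xi2 x y) lo h5 => u v lo h5.
have := sqr_ge0 (u - lam * v + 2 * e); have := sqr_ge0 (v + lam * u + 2 * f).
rewrite /sq in ef lo h5 s0 *; lra.
Qed.

(** With [s = sq x y], the inner product is at least [s^2/4 - 2.1 s], and [s^2 >= 16 s]. *)
Lemma perturbed_field_outward : 16 <= sq x y -> sq x y <= x * g + y * h.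
Proof.
case: gh => lam [e [f [lam1 _ ef -> ->]]] s16.
have := quartic_le x y; rewrite ler_norml => /andP[p1 p2].
have /andP[q1 q2] := pow4_bounds x y.
move: lam1; rewrite ler_norml => /andP[l1 l2].
have -> : x * (xi1 x y - lam * xi2 x y + e) + y * (xi2 x y + lam * xi1 x y + f)
  = - sq x y + (x ^+ 4 + y ^+ 4) + lam * (sq x y + x * y * (x ^+ 2 - y ^+ 2))
    + (x * e + y * f) by rewrite /sq /xi1 /xi2; ring.
have ef1 : - (sq x y / 10) <= x * e + y * f.
  have := sqr_ge0 (x + 10 * e); have := sqr_ge0 (y + 10 * f).
  move: ef; rewrite /sq; lra.
set s := sq x y in s16 p1 p2 q1 q2 ef1 *; set p := x * y * _ in p1 p2 *.
(* The two nonnegative products below add up to [2 (s + s^2/4) + 2 lam (s + p)]. *)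
have lp : - (s + s ^+ 2 / 4) <= lam * (s + p).
  have h1 : 0 <= (1 + lam) * (s + s ^+ 2 / 4 + (s + p)) by rewrite mulr_ge0//; lra.
  have h2 : 0 <= (1 - lam) * (s + s ^+ 2 / 4 - (s + p)) by rewrite mulr_ge0//; lra.
  lra.
have : 16 * s <= s ^+ 2 by nra.
lra.
Qed.

(** With [s = sq x y], the term [- s] dominates the quartic part, at most [s^2 <= s/3], and the
    error, at most [s/10]. The [lam] term is nonpositive because [s + p >= 0] there. *)
Lemma perturbed_field_inward : sq x y <= 1 / 3 -> x * g + y * h <= 0.
Proof.
case: gh => lam [e [f [lam1 lam0 ef -> ->]]] s3.
have := quartic_le x y; rewrite ler_norml => /andP[p1 p2].
have /andP[q1 q2] := pow4_bounds x y.
have {}lam0 := lam0 s3; have s0 := sq_ge0 x y.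
have -> : x * (xi1 x y - lam * xi2 x y + e) + y * (xi2 x y + lam * xi1 x y + f)
  = - sq x y + (x ^+ 4 + y ^+ 4) + lam * (sq x y + x * y * (x ^+ 2 - y ^+ 2))
    + (x * e + y * f) by rewrite /sq /xi1 /xi2; ring.
have ef1 : x * e + y * f <= sq x y / 10.
  have := sqr_ge0 (x - 10 * e); have := sqr_ge0 (y - 10 * f).
  move: ef; rewrite /sq; lra.
set s := sq x y in s3 s0 p1 p2 q1 q2 ef1 *; set p := x * y * _ in p1 p2 *.
have s2 : s ^+ 2 <= s / 3 by nra.
have sp : 0 <= s + p by lra.
have := mulr_le0_ge0 lam0 sp.
lra.
Qed.

Lemma step_sq t : sq (x - t * g) (y - t * h)
  = sq x y - 2 * t * (x * g + y * h) + t ^+ 2 * sq g h.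
Proof. by rewrite /sq; ring. Qed.

(** The rate condition turns the factor [17 (1 + S)^2 a] into at most 17/1000, so the second-order
    term of [step_sq] is negligible against [a * sq x y]. *)
Lemma step_quadratic_term S a : 64 <= S -> sq x y <= S -> 0 < a ->
  a * (1000 * (1 + S) ^+ 2) < 1 ->
  a ^+ 2 * sq g h <= a * (sq x y / 50).
Proof.
move=> S64 sS a0 aS; have S0 : 0 <= S by lra.
have up := perturbed_field_upper S S0 sS.
have h1 := ler_wpM2l (sqr_ge0 a) up; apply: (le_trans h1).
have -> : a ^+ 2 * (17 * (1 + S) ^+ 2 * sq x y)
  = a * ((a * (1000 * (1 + S) ^+ 2)) * (17 / 1000 * sq x y)) by field.
rewrite ler_pM2l//; have s0 := sq_ge0 x y.
have : (a * (1000 * (1 + S) ^+ 2)) * (17 / 1000 * sq x y)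
    <= 1 * (17 / 1000 * sq x y).
  by apply: ler_wpM2r; [lra | exact: ltW].
lra.
Qed.

Lemma rate_small S a : 64 <= S -> 0 < a ->
  a * (1000 * (1 + S) ^+ 2) < 1 -> a * 1000 <= 1.
Proof.
move=> S64 a0 aS; have h3 : 1 <= (1 + S) ^+ 2 by rewrite exprn_ege1//; lra.
have := ler_wpM2l (ltW a0) h3; lra.
Qed.

(** Outside the disc [sq x y <= 16] the step decreases [sq]. Inside it, a step at most doubles [sq]
    up to a small term, hence stays below 64. *)
Lemma step_bounded S a : 64 <= S -> sq x y <= S -> 0 < a ->
  a * (1000 * (1 + S) ^+ 2) < 1 ->
  sq (x - a * g) (y - a * h) <= S.
Proof.
move=> S64 sS a0 aS; rewrite step_sq.
have h1 := step_quadratic_term S a S64 sS a0 aS.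
have h2 := rate_small S a S64 a0 aS; have s0 := sq_ge0 x y.
have as0 := mulr_ge0 (ltW a0) s0.
have h4 := ler_wpM2r s0 h2.
have [s16|/ltW s16] := leP 16 (sq x y).
  have := ler_wpM2l (ltW a0) (perturbed_field_outward s16); lra.
have : - 2 * a * (x * g + y * h) <= sq x y + a ^+ 2 * sq g h.
  by have := sqr_ge0 (x + a * g); have := sqr_ge0 (y + a * h); rewrite /sq; lra.
lra.
Qed.

(** Young's inequality with weights 1/4 and 4 leaves three quarters of [sq x y], minus a small
    multiple of it. *)
Lemma step_not_shrinking S a : 64 <= S -> sq x y <= S -> 0 < a ->
  a * (1000 * (1 + S) ^+ 2) < 1 ->
  sq x y <= 2 * sq (x - a * g) (y - a * h).
Proof.
move=> S64 sS a0 aS; rewrite step_sq.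
have h1 := step_quadratic_term S a S64 sS a0 aS.
have h2 := rate_small S a S64 a0 aS; have s0 := sq_ge0 x y.
have h4 := ler_wpM2r s0 h2.
have : 2 * a * (x * g + y * h) <= sq x y / 4 + 4 * a ^+ 2 * sq g h.
  have := sqr_ge0 (x / 2 - 2 * (a * g)); have := sqr_ge0 (y / 2 - 2 * (a * h)).
  rewrite /sq; lra.
lra.
Qed.

Lemma step_repelled a : 0 < a -> sq x y <= 1 / 3 ->
  sq x y <= sq (x - a * g) (y - a * h).
Proof.
move=> a0 s3; rewrite step_sq.
have := mulr_ge0 (sqr_ge0 a) (sq_ge0 g h).
have := mulr_ge0_le0 (ltW a0) (perturbed_field_inward s3).
lra.
Qed.

(** The step is measured against its endpoint, which is the current point when OMD next looks back
    at the previous one. The factor 34 is 17 times the 2 of [step_not_shrinking]. *)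
Lemma step_displacement S a : 64 <= S -> sq x y <= S -> 0 < a ->
  a * (1000 * (1 + S) ^+ 2) < 1 ->
  sq (a * g) (a * h) <= a ^+ 2 * (34 * (1 + S) ^+ 2) * sq (x - a * g) (y - a * h).
Proof.
move=> S64 sS a0 aS; have S0 : 0 <= S by apply: le_trans S64.
have up := perturbed_field_upper S S0 sS.
have h1 := ler_wpM2l (sqr_ge0 a) up.
have D0 : 0 <= a ^+ 2 * (34 * (1 + S) ^+ 2).
  by rewrite mulr_ge0 ?sqr_ge0// mulr_ge0 ?sqr_ge0//; lra.
have := ler_wpM2l D0 (step_not_shrinking S a S64 sS a0 aS).
have -> : sq (a * g) (a * h) = a ^+ 2 * sq g h by rewrite /sq; ring.
lra.
Qed.

End Step.
End Field.

Definition loss1 {R : realFieldType} (x y : R) : R :=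
  x * y - x ^+ 2 / 2 + y ^+ 2 / 2 + x ^+ 4 / 4 - y ^+ 4 / 4.
Definition loss2 {R : realFieldType} (x y : R) : R := - loss1 x y.

(** * The game *)

Section Algebra2.
Context {R : realType}.
Implicit Types a b c d u v : R.

Lemma vec2P (w : 'cV[R]_2) : w = vec2 (w ord0 ord0) (w ord_max ord0).
Proof.
apply/matrixP => i j; rewrite !mxE (ord1 j).
by case: i => -[|[|//]] Hi /=; congr (w _ _); apply/val_inj.
Qed.

Lemma mx2P (M : 'M[R]_2) :
  M = mx2 (M ord0 ord0) (M ord0 ord_max) (M ord_max ord0) (M ord_max ord_max).
Proof.
apply/matrixP => i j; rewrite !mxE.
by case: i => -[|[|//]] Hi /=; case: j => -[|[|//]] Hj /=; congr (M _ _); apply/val_inj.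
Qed.

Lemma sum2 (F : 'I_2 -> R) : \sum_(i < 2) F i = F ord0 + F ord_max.
Proof. by rewrite big_ord_recr big_ord1 /=; congr (F _ + _); apply/val_inj. Qed.

Lemma vec2_fst u v : vec2 u v ord0 ord0 = u.
Proof. by rewrite mxE. Qed.
Lemma vec2_snd u v : vec2 u v ord_max ord0 = v.
Proof. by rewrite mxE. Qed.
Lemma mul_mx2_vec2 a b c d u v :
  mx2 a b c d *m vec2 u v = vec2 (a * u + b * v) (c * u + d * v).
Proof. by rewrite [LHS]vec2P !mxE !sum2 !mxE. Qed.
Lemma mul_mx2 a b c d a' b' c' d' : mx2 a b c d *m mx2 a' b' c' d'
  = mx2 (a * a' + b * c') (a * b' + b * d') (c * a' + d * c') (c * b' + d * d').
Proof. by rewrite [LHS]mx2P !mxE !sum2 !mxE. Qed.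
Lemma tr_mx2 a b c d : (mx2 a b c d)^T = mx2 a c b d.
Proof. by rewrite [LHS]mx2P !mxE. Qed.
Lemma scalar_mx2 a : a%:M = mx2 a 0 0 a.
Proof. by rewrite [LHS]mx2P !mxE. Qed.
Lemma add_vec2 u v u' v' : vec2 u v + vec2 u' v' = vec2 (u + u') (v + v').
Proof. by rewrite [LHS]vec2P !mxE. Qed.
Lemma opp_vec2 u v : - vec2 u v = vec2 (- u) (- v).
Proof. by rewrite [LHS]vec2P !mxE. Qed.
Lemma scale_vec2 a u v : a *: vec2 u v = vec2 (a * u) (a * v).
Proof. by rewrite [LHS]vec2P !mxE. Qed.
Lemma add_mx2 a b c d a' b' c' d' :
  mx2 a b c d + mx2 a' b' c' d' = mx2 (a + a') (b + b') (c + c') (d + d').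
Proof. by rewrite [LHS]mx2P !mxE. Qed.
Lemma opp_mx2 a b c d : - mx2 a b c d = mx2 (- a) (- b) (- c) (- d).
Proof. by rewrite [LHS]mx2P !mxE. Qed.
Lemma scale_mx2 e a b c d : e *: mx2 a b c d = mx2 (e * a) (e * b) (e * c) (e * d).
Proof. by rewrite [LHS]mx2P !mxE. Qed.
Lemma offdiag_mx2 a b c d : offdiag (mx2 a b c d) = mx2 0 b c 0.
Proof. by rewrite [LHS]mx2P !mxE. Qed.
Lemma diagv_mx2 a b c d : diagv (mx2 a b c d) = vec2 a d.
Proof. by rewrite [LHS]vec2P !mxE. Qed.
Lemma dotv_vec2 u v u' v' : dotv (vec2 u v) (vec2 u' v') = u * u' + v * v'.
Proof. by rewrite /dotv sum2 !mxE. Qed.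
Lemma topair_vec2 u v : topair (vec2 u v) = (u, v).
Proof. by rewrite /topair !mxE. Qed.

Definition algebra2E := (mul_mx2_vec2, mul_mx2, tr_mx2, scalar_mx2, add_vec2,
  opp_vec2, scale_vec2, add_mx2, opp_mx2, scale_mx2, offdiag_mx2, diagv_mx2,
  dotv_vec2, topair_vec2, vec2_fst, vec2_snd).

Lemma det_mx2 a b c d : \det (mx2 a b c d) = a * d - b * c.
Proof.
rewrite (expand_det_row _ ord0) sum2 /cofactor !det_mx11 !mxE /=.
by rewrite !expr0 !expr1; ring.
Qed.
End Algebra2.

(** * Derivatives, critical point and coercivity *)

Section Game.
Context {R : realType}.
Implicit Types (x y : R) (p : R * R).

(** With one variable frozen, every function differentiated below is a polynomial of degree at most
    4 in the other, so formal derivation of polynomials gives all partial derivatives. *)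
Lemma derive1_quartic (c0 c1 c2 c3 c4 : R) (h : R -> R) x :
  (forall t, h t = c0 + c1 * t + c2 * t ^+ 2 + c3 * t ^+ 3 + c4 * t ^+ 4) ->
  derive1 h x = c1 + 2 * c2 * x + 3 * c3 * x ^+ 2 + 4 * c4 * x ^+ 3.
Proof.
move=> hE; pose p := Poly [:: c0; c1; c2; c3; c4].
have -> : h = horner p.
  by apply/funext => t; rewrite hE horner_Poly /=; ring.
set r := RHS; rewrite -derivE /p /= !cons_poly_def !poly.derivE !hornerE /r; ring.
Qed.

Lemma dx_loss1 : dx loss1 = xi1 :> (R -> R -> R).
Proof.
apply/funext => x; apply/funext => y; rewrite /dx /xi1.
rewrite (@derive1_quartic (y ^+ 2 / 2 - y ^+ 4 / 4) y (- 2^-1) 0 4^-1).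
  by field.
by move=> t; rewrite /loss1; field.
Qed.

Lemma dy_loss1 : dy loss1 = (fun x y => - xi2 x y) :> (R -> R -> R).
Proof.
apply/funext => x; apply/funext => y; rewrite /dy /xi2.
rewrite (@derive1_quartic (x ^+ 4 / 4 - x ^+ 2 / 2) x (2^-1) 0 (- 4^-1)).
  by field.
by move=> t; rewrite /loss1; field.
Qed.

Lemma dx_loss2 : dx loss2 = (fun x y => - xi1 x y) :> (R -> R -> R).
Proof.
apply/funext => x; apply/funext => y; rewrite /dx /xi1.
rewrite (@derive1_quartic (y ^+ 4 / 4 - y ^+ 2 / 2) (- y) (2^-1) 0 (- 4^-1)).
  by field.
by move=> t; rewrite /loss2 /loss1; field.
Qed.

Lemma dy_loss2 : dy loss2 = xi2 :> (R -> R -> R).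
Proof.
apply/funext => x; apply/funext => y; rewrite /dy /xi2.
rewrite (@derive1_quartic (x ^+ 2 / 2 - x ^+ 4 / 4) (- x) (- 2^-1) 0 (4^-1)).
  by field.
by move=> t; rewrite /loss2 /loss1; field.
Qed.

Lemma xi_loss p : xi loss1 loss2 p = vec2 (xi1 p.1 p.2) (xi2 p.1 p.2).
Proof. by rewrite /xi dx_loss1 dy_loss2. Qed.

Lemma hess_loss p : hess loss1 loss2 p
  = mx2 (- 1 + 3 * p.1 ^+ 2) 1 (- 1) (- 1 + 3 * p.2 ^+ 2).
Proof.
rewrite /hess dx_loss1 dy_loss2 /dx /dy; congr mx2.
- rewrite (@derive1_quartic p.2 (- 1) 0 1 0); first by ring.
  by move=> t; rewrite /xi1; ring.
- rewrite (@derive1_quartic (- p.1 + p.1 ^+ 3) 1 0 0 0); first by ring.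
  by move=> t; rewrite /xi1; ring.
- rewrite (@derive1_quartic (- p.2 + p.2 ^+ 3) (- 1) 0 0 0); first by ring.
  by move=> t; rewrite /xi2; ring.
- rewrite (@derive1_quartic (- p.1) (- 1) 0 1 0); first by ring.
  by move=> t; rewrite /xi2; ring.
Qed.

Lemma gradL_loss p : gradL loss1 loss2 p
  = mx2 (xi1 p.1 p.2) (- xi1 p.1 p.2) (- xi2 p.1 p.2) (xi2 p.1 p.2).
Proof. by rewrite /gradL dx_loss1 dy_loss1 dx_loss2 dy_loss2. Qed.

Lemma sq_eq0 x y : sq x y = 0 -> x = 0 /\ y = 0.
Proof.
move=> /eqP; rewrite paddr_eq0 ?sqr_ge0// !sqrf_eq0.
by move=> /andP[/eqP ? /eqP ?].
Qed.

Lemma critical_loss p : critical loss1 loss2 p -> p = (0, 0).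
Proof.
rewrite /critical xi_loss => v0.
have z1 : xi1 p.1 p.2 = 0 by rewrite -(vec2_fst (xi1 _ _) (xi2 p.1 p.2)) v0 mxE.
have z2 : xi2 p.1 p.2 = 0 by rewrite -(vec2_snd (xi1 p.1 p.2) (xi2 _ _)) v0 mxE.
have := xi_lower p.1 p.2; rewrite z1 z2 {2}/sq expr0n addr0 mulr0 => s0.
have [] : p.1 = 0 /\ p.2 = 0 by apply: sq_eq0; apply/eqP; rewrite eq_le s0 sq_ge0.
by case: p {v0 z1 z2 s0} => ? ? /= -> ->.
Qed.

(** At the origin the Hessian is [- I] plus an antisymmetric matrix, so its quadratic form is
    [- |u|^2]. *)
Lemma strict_max_loss : strict_max loss1 loss2 ((0, 0) : R * R).
Proof.
split; first by rewrite /critical xi_loss /xi1 /xi2 /= [RHS]vec2P !mxE; congr vec2; ring.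
move=> u u0; rewrite hess_loss /= [u]vec2P -mulmxA mul_mx2_vec2.
set x := u _ _; set y := u _ _.
have -> : ((vec2 x y)^T *m vec2 ((-1 + 3 * 0 ^+ 2) * x + 1 * y)
   (-1 * x + (-1 + 3 * 0 ^+ 2) * y)) ord0 ord0 = - sq x y.
  by rewrite mxE sum2 !mxE /= /sq; ring.
rewrite oppr_lt0 lt_neqAle sq_ge0 andbT eq_sym; apply: contra u0 => /eqP/sq_eq0[x0 y0].
by rewrite [u]vec2P -/x -/y x0 y0; apply/eqP; rewrite [RHS]vec2P !mxE.
Qed.

Lemma nondegenerate_loss : @nondegenerate_game R loss1 loss2.
Proof.
move=> p /critical_loss ->; rewrite unitmxE hess_loss /= det_mx2 unitfE.
by apply: lt0r_neq0; lra.
Qed.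

Lemma weakly_coercive_loss : @weakly_coercive R loss1 loss2.
Proof.
(* Up to a constant, each loss has this form in its own variable: [z] is [y] for [loss1] and [- x]
   for [loss2]. *)
have main (z M : R) : exists r : R, forall x, r < `|x| ->
    M < z * x - x ^+ 2 / 2 + x ^+ 4 / 4.
  (* Beyond this radius [x^4/4 >= 4 x^2], while [|z x|] and [|M|] are each at most [x^2]. *)
  exists (4 + `|z| + `|M|) => x xr.
  have z0 := normr_ge0 z; have M0 := normr_ge0 M; have x2 : 0 <= `|x| by [].
  have zx : - (`|z| * `|x|) <= z * x.
    by rewrite lerNl -mulNr; apply: le_trans (ler_norm _) _; rewrite normrM normrN.
  have -> : x ^+ 4 = `|x| ^+ 2 ^+ 2 by rewrite real_normK ?num_real// -exprM.
  have -> : x ^+ 2 = `|x| ^+ 2 by rewrite real_normK ?num_real.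
  have MM := ler_norm M.
  have h1 : 16 <= `|x| ^+ 2 by nra.
  have h2 : 16 * `|x| ^+ 2 <= `|x| ^+ 2 ^+ 2 by nra.
  have h3 : `|z| * `|x| <= `|x| ^+ 2 by nra.
  have h4 : `|M| < `|x| ^+ 2 by nra.
  lra.
split=> [y|x] M.
  have [r rP] := main y (M - y ^+ 2 / 2 + y ^+ 4 / 4).
  by exists r => x /rP; rewrite /loss1; lra.
have [r rP] := main (- x) (M - x ^+ 2 / 2 + x ^+ 4 / 4).
by exists r => y /rP; rewrite /loss2 /loss1; lra.
Qed.

End Game.

(** * Analyticity of the losses *)

Section Analytic.
Context {R : realType}.

Lemma truncated_double_sum (F : nat -> nat -> R) (N m : nat) :
  (forall i j, (N <= i)%N || (N <= j)%N -> F i j = 0) ->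
  \sum_(i < N + m) \sum_(j < N + m) F i j = \sum_(i < N) \sum_(j < N) F i j.
Proof.
move=> F0; rewrite big_split_ord /= [X in _ + X]big1 ?addr0; last first.
  by move=> i _; rewrite big1// => j _; rewrite F0// leq_addr.
apply: eq_bigr => i _; rewrite big_split_ord /= [X in _ + X]big1 ?addr0// => j _.
by rewrite F0// leq_addr orbT.
Qed.

Lemma analytic2_polynomial (f : R -> R -> R) (N : nat) :
  (forall a b, exists2 c : nat -> nat -> R,
    forall i j, (N <= i)%N || (N <= j)%N -> c i j = 0 &
    forall x y, f x y =
      \sum_(i < N) \sum_(j < N) c i j * (x - a) ^+ i * (y - b) ^+ j) ->
  analytic2 f.
Proof.
move=> fE a b; have [c c0 cE] := fE a b; exists c, 1; split=> // x y _ _; split.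
  exists (\sum_(i < N) \sum_(j < N) `|c i j| * `|x - a| ^+ i * `|y - b| ^+ j) => n.
  pose F i j := `|c i j| * `|x - a| ^+ i * `|y - b| ^+ j.
  have F_ge0 i j : 0 <= F i j by rewrite !mulr_ge0// exprn_ge0.
  (* Padding the bound to [N + n] terms per index makes it contain the [n]-term sum, whichever of
     [n] and [N] is larger. *)
  rewrite -(@truncated_double_sum F N n); last first.
    by move=> i j /c0; rewrite /F => ->; rewrite normr0 !mul0r.
  rewrite addnC big_split_ord /= -[leLHS]addr0 lerD ?sumr_ge0// => [|i _]; last first.
    by rewrite sumr_ge0.
  apply: ler_sum => i _; rewrite big_split_ord /= -[leLHS]addr0.
  by rewrite lerD// sumr_ge0.
pose F i j := c i j * (x - a) ^+ i * (y - b) ^+ j.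
rewrite cE; apply: cvg_near_cst; exists N => // n /= Nn.
rewrite -(subnKC Nn) (@truncated_double_sum F)// => i j /c0.
by rewrite /F => ->; rewrite !mul0r.
Qed.

Definition loss1_taylor (a b : R) (i j : nat) : R :=
  match i, j with
  | 0%N, 0%N => loss1 a b
  | 1%N, 0%N => xi1 a b
  | 2%N, 0%N => (3 * a ^+ 2 - 1) / 2
  | 3%N, 0%N => a
  | 4%N, 0%N => 4^-1
  | 0%N, 1%N => - xi2 a b
  | 0%N, 2%N => (1 - 3 * b ^+ 2) / 2
  | 0%N, 3%N => - b
  | 0%N, 4%N => - 4^-1
  | 1%N, 1%N => 1
  | _, _ => 0
  end.

Lemma analytic2_scale_loss1 (e : R) : analytic2 (fun x y => e * loss1 x y).
Proof.
apply: (@analytic2_polynomial _ 5) => a b.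
exists (fun i j => e * loss1_taylor a b i j) => [i j|x y].
  case: i => [|[|[|[|[|i]]]]]; case: j => [|[|[|[|[|j]]]]] //= _;
  by rewrite mulr0.
rewrite !big_ord_recr !big_ord0 /= /loss1 /xi1 /xi2; by field.
Qed.

Lemma analytic2_loss1 : @analytic2 R loss1.
Proof.
have -> : loss1 = (fun x y => 1 * loss1 x y) :> (R -> R -> R).
  by apply/funext => x; apply/funext => y; rewrite mul1r.
exact: analytic2_scale_loss1.
Qed.

Lemma analytic2_loss2 : @analytic2 R loss2.
Proof.
have -> : loss2 = (fun x y => - 1 * loss1 x y) :> (R -> R -> R).
  by apply/funext => x; apply/funext => y; rewrite mulN1r.
exact: analytic2_scale_loss1.
Qed.

End Analytic.

(** * Almost sure properties of the initial point *)

Section Null.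
Context {R : realType}.

(** Absolute continuity discards the origin, a Lebesgue-null point. Bounded support discards the
    complement of a square, on which [sq] is at most [2 M^2]. *)
Lemma ae_bounded_nonzero (P : probability (R * R)%type R) :
  P `<< @leb2 R -> bounded_support P ->
  exists M : R, {ae P, forall p, sq p.1 p.2 <= M /\ p <> (0, 0)}.
Proof.
move=> Pleb [M PM]; exists (2 * M ^+ 2).
pose Q : set (R * R) := `[- M, M]%classic `*` `[- M, M]%classic.
have QE : [set p : R * R | `|p.1| <= M /\ `|p.2| <= M] = Q.
  by apply/seteqP; split=> -[x y]; rewrite /Q /= !in_itv /= !ler_norml.
have mQ : measurable Q by exact: measurableX.
have set00 : [set (0, 0) : R * R] = [set 0] `*` [set 0].
  by apply/seteqP; split=> -[x y] /=; [case=> -> -> | case=> -> ->].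
have m0 : measurable [set (0, 0) : R * R].
  by rewrite set00; exact: measurableX.
have leb0 : @leb2 R [set (0, 0)] = 0%E.
  by rewrite set00 /leb2 product_measure1E//= lebesgue_measure_set1 mul0e.
have nul0 : P.-negligible [set (0, 0)].
  apply/negligibleP => //.
  have : (@leb2 R).-null_set [set (0, 0)] by exact/measure0_null_setP.
  by move=> /Pleb; exact.
have nulQ : P.-negligible (~` Q).
  apply/negligibleP; first exact: measurableC.
  by apply: etrans (probability_setC P mQ) _; rewrite -QE PM subee.
apply: negligibleS (negligibleU nul0 nulQ) => -[x y] /= /not_andP[]; last first.
  by move=> /contrapT ->; left.
move=> nle; right => -[/=]; rewrite !in_itv /= => xM yM; apply: nle.
rewrite /sq; nra.
Qed.
End Null.

(** * The ten algorithms as perturbations of the field *)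

Section Algorithms.
Context {R : realType}.
Implicit Types (p : R * R) (x y e f S t alpha gamma a b : R).

(** Take [lam = 0]. The constant 6800 = 200 * 34 is the Lipschitz constant of [xi_lipschitz] times
    the displacement constant; the rate condition brings the error down to [68/10000 * sq x y]. *)
Lemma perturbed_xi S t x y e f : 0 <= S -> 0 < t -> t * (1000 * (1 + S) ^+ 2) < 1 ->
  sq e f <= t ^+ 2 * (6800 * (1 + S) ^+ 4) * sq x y ->
  perturbed_field x y (xi1 x y + e) (xi2 x y + f).
Proof.
move=> S0 t0 tS ef; exists 0, e, f; split=> //; first by rewrite normr0.
- apply: (le_trans ef).
  have -> : t ^+ 2 * (6800 * (1 + S) ^+ 4) * sq x y
     = (t * (1000 * (1 + S) ^+ 2)) ^+ 2 * (68 / 10000 * sq x y) by field.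
  have s0 := sq_ge0 x y.
  have h1 : 0 <= t * (1000 * (1 + S) ^+ 2).
    by have D0 := sqr_ge0 (1 + S); apply: mulr_ge0; [exact: ltW | lra].
  have h2 := exprn_ile1 2 h1 (ltW tS).
  move: (t * _) h1 h2 => w h1 h2.
  have := ler_wpM2r s0 h2; lra.
- by rewrite mul0r subr0.
- by rewrite mul0r addr0.
Qed.

Lemma perturbed_xi_relative S t x y e f : 0 <= S -> sq x y <= S ->
  0 < t -> t * (1000 * (1 + S) ^+ 2) < 1 ->
  sq e f <= t ^+ 2 * (20 * (1 + S) ^+ 2) * sq (xi1 x y) (xi2 x y) ->
  perturbed_field x y (xi1 x y + e) (xi2 x y + f).
Proof.
move=> S0 sS t0 tS ef; apply: (perturbed_xi _ _ _ _ _ _ S0 t0 tS).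
apply: (le_trans ef).
have h1 : 0 <= t ^+ 2 * (20 * (1 + S) ^+ 2).
  by have D0 := sqr_ge0 (1 + S); apply: mulr_ge0; [exact: sqr_ge0 | lra].
have := ler_wpM2l h1 (xi_upper S x y sS).
have : 0 <= t ^+ 2 * (1 + S) ^+ 4 * sq x y.
  by rewrite mulr_ge0 ?sq_ge0// mulr_ge0 ?sqr_ge0// exprn_ge0//; lra.
lra.
Qed.

(** For corrections of size [t |xi|]. The bound 4 is attained by LOLA, whose correction is
    [2 alpha A^T xi]. *)
Lemma perturbed_xi_rotation S t x y e f c : 0 <= S -> sq x y <= S ->
  0 < t -> t * (1000 * (1 + S) ^+ 2) < 1 -> c <= 4 ->
  sq e f <= c * t ^+ 2 * sq (xi1 x y) (xi2 x y) ->
  perturbed_field x y (xi1 x y + e) (xi2 x y + f).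
Proof.
move=> S0 sS t0 tS c4 ef; apply: (perturbed_xi_relative S t) => //.
apply: (le_trans ef); rewrite (mulrC c) ler_wpM2r ?sq_ge0//.
rewrite ler_wpM2l ?sqr_ge0//.
have : 1 <= (1 + S) ^+ 2 by rewrite exprn_ege1//; lra.
lra.
Qed.

(** For [xi] evaluated at a shifted point: [c = 1] gives EG and [c = - 1] gives OMD. *)
Lemma perturbed_xi_shift S t x y e f c : 64 <= S -> sq x y <= S ->
  0 < t -> t * (1000 * (1 + S) ^+ 2) < 1 -> c ^+ 2 = 1 ->
  sq e f <= t ^+ 2 * (34 * (1 + S) ^+ 2) * sq x y ->
  perturbed_field x y (xi1 x y + c * (xi1 (x + e) (y + f) - xi1 x y))
                      (xi2 x y + c * (xi2 (x + e) (y + f) - xi2 x y)).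
Proof.
move=> S64 sS t0 tS c1 ef; have S0 : 0 <= S by lra.
have D1 : 1 <= 1 + S by lra.
have D2 : 1 <= (1 + S) ^+ 2 by rewrite exprn_ege1.
have ef1 : sq e f <= 1.
  apply: (le_trans ef).
  have h1 : 0 <= t * (1000 * (1 + S) ^+ 2) by apply: mulr_ge0; [exact: ltW | lra].
  have h2 := exprn_ile1 2 h1 (ltW tS).
  have h3 : sq x y <= (1 + S) ^+ 2 by nra.
  have h4 : 0 <= t ^+ 2 * (34 * (1 + S) ^+ 2) by apply: mulr_ge0; [exact: sqr_ge0 | lra].
  have h5 := ler_wpM2l h4 h3.
  have h6 : 0 <= t ^+ 2 * (1 + S) ^+ 4 by rewrite mulr_ge0 ?sqr_ge0// exprn_ge0//; lra.
  lra.
apply: (perturbed_xi S t) => //.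
have -> : sq (c * (xi1 (x + e) (y + f) - xi1 x y)) (c * (xi2 (x + e) (y + f) - xi2 x y))
    = sq (xi1 (x + e) (y + f) - xi1 x y) (xi2 (x + e) (y + f) - xi2 x y).
  by rewrite /sq !exprMn c1 !mul1r.
apply: (le_trans (xi_lipschitz S _ _ _ _ sS S0 ef1)).
have h : 0 <= 200 * (1 + S) ^+ 2 by lra.
have := ler_wpM2l h ef; lra.
Qed.

(** Here [(H1, H2)] is [H^T xi]. On the disc [sq x y <= 1/3] the symmetric part of [H] is negative
    semidefinite, so the first factor under the sign is nonpositive; the second is [u^2 + v^2] plus
    a cross term with coefficient at most 1 in absolute value, hence nonnegative. *)
Lemma sga_perturbed x y : 
  let u := xi1 x y in let v := xi2 x y in
  let H1 := (- 1 + 3 * x ^+ 2) * u + - 1 * v in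
  let H2 := 1 * u + (- 1 + 3 * y ^+ 2) * v in
  let lam := Num.sg ((u * H1 + v * H2) * (- v * H1 + u * H2)) in
  perturbed_field x y (u - lam * v) (v + lam * u).
Proof.
move=> u v H1 H2 lam; exists lam, 0, 0; split.
- by rewrite /lam normr_sg; case: (_ != 0).
- move=> s3; rewrite /lam sgr_le0; apply: mulr_le0_ge0.
    have -> : u * H1 + v * H2
        = - ((1 - 3 * x ^+ 2) * u ^+ 2 + (1 - 3 * y ^+ 2) * v ^+ 2).
      by rewrite /H1 /H2; ring.
    have x2 := sqr_ge0 x; have y2 := sqr_ge0 y; rewrite /sq in s3.
    by rewrite oppr_le0 addr_ge0// mulr_ge0 ?sqr_ge0//; lra.
  have -> : - v * H1 + u * H2 = u ^+ 2 + v ^+ 2 + 3 * (y ^+ 2 - x ^+ 2) * (u * v).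
    by rewrite /H1 /H2; ring.
  have x2 := sqr_ge0 x; have y2 := sqr_ge0 y; rewrite /sq in s3.
  have h1 : 0 <= (1 + 3 * (y ^+ 2 - x ^+ 2)) * (u + v) ^+ 2.
    by rewrite mulr_ge0 ?sqr_ge0//; lra.
  have h2 : 0 <= (1 - 3 * (y ^+ 2 - x ^+ 2)) * (u - v) ^+ 2.
    by rewrite mulr_ge0 ?sqr_ge0//; lra.
  have u2 := sqr_ge0 u; have v2 := sqr_ge0 v; lra.
- have -> : sq 0 0 = 0 :> R by rewrite /sq expr0n addr0.
  by have := sq_ge0 x y; lra.
- by rewrite addr0.
- by rewrite addr0.
Qed.

(** This places the SOS correction between those of LA and LOLA. *)
Lemma sos_p_itv alpha a b p : 0 < a -> 0 < b < 1 ->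
  0 <= sos_p loss1 loss2 alpha a b p <= 1.
Proof.
move=> a0 /andP[b0 b1]; rewrite /sos_p.
set d := dotv _ _; set n := norm2 (la_part _ _ _ _); set m := norm2 (xi _ _ _).
have norm2_ge0 (w : 'cV[R]_2) : 0 <= norm2 w.
  by apply: sumr_ge0 => i _; rewrite -expr2 sqr_ge0.
have m0 : 0 <= m by exact: norm2_ge0.
have n0 : 0 <= n by exact: norm2_ge0.
rewrite le_min ge_min; apply/andP; split; [apply/andP; split|].
- have [//|d0] := leP 0 d.
  rewrite le_min ler01 /=; apply: mulr_le0; last by rewrite invr_le0 ltW.
  by rewrite mulNr oppr_le0 mulr_ge0// ltW.
- by case: ifP.
- apply/orP; left; case: ifP => // _. by rewrite ge_min lexx.
Qed.

Lemma la_part_loss alpha p : la_part loss1 loss2 alpha p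
  = vec2 (xi1 p.1 p.2 - alpha * xi2 p.1 p.2) (xi2 p.1 p.2 + alpha * xi1 p.1 p.2) :> 'cV[R]_2.
Proof.
by rewrite /la_part /Ho hess_loss xi_loss !algebra2E; congr vec2; ring.
Qed.

(** The vector [chi] is [- A^T xi], so subtracting [alpha chi] doubles the correction [alpha A^T xi]
    of LA. *)
Lemma chi_loss p : chi loss1 loss2 p = vec2 (xi2 p.1 p.2) (- xi1 p.1 p.2) :> 'cV[R]_2.
Proof.
by rewrite /chi /Ho hess_loss gradL_loss !algebra2E; congr vec2; ring.
Qed.

(** The matrix [I + alpha Ho] is a scaled rotation of determinant [1 + alpha^2]; the inverse is
    checked by multiplying back. *)
Lemma cgd_loss alpha gamma a b prev p : G loss1 loss2 CGD alpha gamma a b prev p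
  = vec2 ((xi1 p.1 p.2 - alpha * xi2 p.1 p.2) / (1 + alpha ^+ 2))
      ((xi2 p.1 p.2 + alpha * xi1 p.1 p.2) / (1 + alpha ^+ 2)) :> 'cV[R]_2.
Proof.
have d0 : 1 + alpha ^+ 2 != 0 by apply: lt0r_neq0; have := sqr_ge0 alpha; lra.
rewrite /G /Ho hess_loss xi_loss; set w := vec2 (_ / _) _.
set M := _ + _.
have <- : M *m w = vec2 (xi1 p.1 p.2) (xi2 p.1 p.2).
  by rewrite /M /w !algebra2E; congr vec2; field.
rewrite mulKmx// unitmxE /M !algebra2E det_mx2 unitfE.
suff -> : (1 + alpha * 0) * (1 + alpha * 0) - (0 + alpha * 1) * (0 + alpha * -1)
  = 1 + alpha ^+ 2 by [].
by ring.
Qed.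

Definition perturbed (p : R * R) (w : 'cV[R]_2) :=
  perturbed_field p.1 p.2 (w ord0 ord0) (w ord_max ord0).

Lemma perturbed_G alg S alpha gamma a b (prev cur : R * R) :
  0 < a -> 0 < b < 1 -> 64 <= S -> sq cur.1 cur.2 <= S ->
  0 < alpha -> alpha * (1000 * (1 + S) ^+ 2) < 1 ->
  0 < gamma -> gamma * (1000 * (1 + S) ^+ 2) < 1 ->
  sq (prev.1 - cur.1) (prev.2 - cur.2)
    <= alpha ^+ 2 * (34 * (1 + S) ^+ 2) * sq cur.1 cur.2 ->
  perturbed cur (G loss1 loss2 alg alpha gamma a b prev cur).
Proof.
move=> a0 b01 S64 sS al0 alS ga0 gaS prevS.
have S0 : 0 <= S by lra.
have D1 : 1 <= (1 + S) ^+ 2 by rewrite exprn_ege1//; lra.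
case: cur sS prevS => x y /= sS prevS.
have up := xi_upper S x y sS; have s0 := sq_ge0 x y.
have u0 := sq_ge0 (xi1 x y) (xi2 x y).
(* The correction [c alpha A^T xi] covers GD, LA, LOLA and SOS, with [c] equal to 0, 1, 2 and
   [1 + p]. *)
have rot c : 0 <= c <= 2 -> perturbed_field x y
    (xi1 x y + - (c * alpha) * xi2 x y) (xi2 x y + c * alpha * xi1 x y).
  move=> c02; apply: (perturbed_xi_rotation S alpha _ _ _ _ (c ^+ 2)) => //; first by nra.
  by rewrite /sq; lra.
case: alg.
- have := rot 0 ltac:(lra); rewrite /perturbed /G xi_loss !algebra2E.
  by rewrite !(oppr0, mul0r, addr0).
(* AGD: [xi2] is affine in [x] with slope [- 1], so the alternating update adds exactly
   [alpha * xi1]. *)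
- rewrite /perturbed /G !xi_loss !algebra2E /=.
  have -> : xi1 x y = xi1 x y + 0 by rewrite addr0.
  have -> : xi2 (x - alpha * (xi1 x y + 0)) y = xi2 x y + alpha * xi1 x y.
    by rewrite addr0 /xi2; ring.
  apply: (perturbed_xi_rotation S alpha _ _ _ _ 1) => //; first by lra.
  have := mulr_ge0 (sqr_ge0 alpha) (sqr_ge0 (xi2 x y)).
  by rewrite /sq; lra.
- have h : sq (- alpha * xi1 x y) (- alpha * xi2 x y)
      <= alpha ^+ 2 * (34 * (1 + S) ^+ 2) * sq x y.
    have := ler_wpM2l (sqr_ge0 alpha) up.
    have := mulr_ge0 (sqr_ge0 alpha) (mulr_ge0 (le_trans ler01 D1) s0).
    by rewrite /sq; lra.
  have := perturbed_xi_shift S alpha x y _ _ 1 S64 sS al0 alS (expr1n _ _) h.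
  rewrite /perturbed /G !xi_loss !algebra2E /=.
  by rewrite !mulNr; congr perturbed_field; ring.
- have := perturbed_xi_shift S alpha x y (prev.1 - x) (prev.2 - y) (- 1)
    S64 sS al0 alS ltac:(by rewrite sqrrN expr1n) prevS.
  rewrite /perturbed /G !xi_loss !algebra2E /= !subrKC.
  by congr perturbed_field; ring.
- rewrite /perturbed /G /antisym hess_loss xi_loss !algebra2E /=.
  have := sga_perturbed x y; rewrite /=.
  set l := Num.sg _; set l' := Num.sg _.
  have -> : l = l' by rewrite /l /l'; congr Num.sg; field.
  by congr perturbed_field; field.
(* CO: the diagonal entries of [H] have squares at most [9 (1 + S)^2] and the others square to 1, so
   the constant is 20 = 2 (9 + 1). *)
- have D0 : 0 <= 1 + S by lra.
  have x2 := sqr_ge0 x; have y2 := sqr_ge0 y.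
  have pow z : 0 <= z ^+ 2 <= S -> (- 1 + 3 * z ^+ 2) ^+ 2 <= 9 * (1 + S) ^+ 2.
    by move=> z2; nra.
  have px := pow x ltac:(move: sS; rewrite /sq; lra).
  have py := pow y ltac:(move: sS; rewrite /sq; lra).
  have h : sq (gamma * ((- 1 + 3 * x ^+ 2) * xi1 x y - xi2 x y))
      (gamma * (xi1 x y + (- 1 + 3 * y ^+ 2) * xi2 x y))
    <= gamma ^+ 2 * (20 * (1 + S) ^+ 2) * sq (xi1 x y) (xi2 x y).
    rewrite /sq !exprMn -mulrDr -mulrA ler_wpM2l ?sqr_ge0//.
    move: (xi1 x y) (xi2 x y) => u v.
    move: (- 1 + 3 * x ^+ 2) (- 1 + 3 * y ^+ 2) px py => p q px py.
    have h1 := ler_wpM2r (sqr_ge0 u) px; have h2 := ler_wpM2r (sqr_ge0 v) py.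
    have h3 := ler_wpM2r (sqr_ge0 u) D1; have h4 := ler_wpM2r (sqr_ge0 v) D1.
    have := sqr_ge0 (p * u + v); have := sqr_ge0 (u - q * v); lra.
  have := perturbed_xi_relative S gamma x y _ _ S0 sS ga0 gaS h.
  rewrite /perturbed /G hess_loss xi_loss !algebra2E /=.
  by congr perturbed_field; ring.
- pose d := 1 + alpha ^+ 2.
  have d0 : d != 0 by apply: lt0r_neq0; have := sqr_ge0 alpha; rewrite /d; lra.
  rewrite /perturbed cgd_loss !algebra2E /=.
  have -> : (xi1 x y - alpha * xi2 x y) / (1 + alpha ^+ 2)
    = xi1 x y + (- alpha ^+ 2 * xi1 x y - alpha * xi2 x y) / d by rewrite /d; field.
  have -> : (xi2 x y + alpha * xi1 x y) / (1 + alpha ^+ 2)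
    = xi2 x y + (- alpha ^+ 2 * xi2 x y + alpha * xi1 x y) / d by rewrite /d; field.
  (* The squared error is exactly [alpha^2 |xi|^2 / d]. *)
  apply: (perturbed_xi_rotation S alpha _ _ _ _ d^-1) => //.
    have : d^-1 <= 1 by rewrite invf_le1 /d; have := sqr_ge0 alpha; lra.
    lra.
  by rewrite le_eqVlt; apply/orP; left; apply/eqP; rewrite /sq /d; field.
- have := rot 1 ltac:(lra); rewrite /perturbed /G la_part_loss !algebra2E /=.
  by rewrite !mul1r mulNr.
- have := rot 2 ltac:(lra); rewrite /perturbed /G la_part_loss chi_loss !algebra2E /=.
  by congr perturbed_field; ring.
- have /andP[p0 p1] := sos_p_itv alpha a b (x, y) a0 b01.
  have := rot (1 + sos_p loss1 loss2 alpha a b (x, y)) ltac:(lra).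
  rewrite /perturbed /G la_part_loss chi_loss !algebra2E /=.
  by congr perturbed_field; ring.
Qed.
End Algorithms.

(** * Dynamics of the iterates *)

Section Dynamics.
Context {R : realType}.
Implicit Types (u : nat -> R * R).

Lemma cvg_increments_small u (l : R * R) (e : R) : u @ \oo --> l -> 0 < e ->
  exists N, forall k, (N <= k)%N ->
    sq ((u k.+1).1 - (u k).1) ((u k.+1).2 - (u k).2) < e.
Proof.
move=> ul e0.
have c1 : (fun k => (u k).1) @ \oo --> l.1 by exact: cvg_comp ul (@cvg_fst _ _ _ _ _).
have c2 : (fun k => (u k).2) @ \oo --> l.2 by exact: cvg_comp ul (@cvg_snd _ _ _ _ _).
have d1 : (fun k => (u k.+1).1 - (u k).1) @ \oo --> (0 : R).
  rewrite -(subrr l.1); apply: cvgB => //.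
  by rewrite (cvg_shiftS (fun k => (u k).1)).
have d2 : (fun k => (u k.+1).2 - (u k).2) @ \oo --> (0 : R).
  rewrite -(subrr l.2); apply: cvgB => //.
  by rewrite (cvg_shiftS (fun k => (u k).2)).
have d : (fun k => sq ((u k.+1).1 - (u k).1) ((u k.+1).2 - (u k).2)) @ \oo --> (0 : R).
  rewrite -[0 : R](addr0) -[X in X + _](mulr0 0) -[X in _ + X](mulr0 0).
  exact: cvgD (cvgM d1 d1) (cvgM d2 d2).
have [N _ NP] := (cvgrPdist_lt _ _).1 d _ e0; exists N => k /NP /=.
by rewrite sub0r normrN => /(le_lt_trans (ler_norm _)).
Qed.

Variables (alg : algo) (S alpha gamma a b : R) (th0 : R * R).
Hypotheses (a0 : 0 < a) (b01 : 0 < b < 1) (S64 : 64 <= S).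
Hypotheses (al0 : 0 < alpha) (alS : alpha * (1000 * (1 + S) ^+ 2) < 1).
Hypotheses (ga0 : 0 < gamma) (gaS : gamma * (1000 * (1 + S) ^+ 2) < 1).
Hypotheses (th0S : sq th0.1 th0.2 <= S) (th0_neq0 : th0 <> (0, 0)).

Local Notation pairs := (iter_pairs loss1 loss2 alg alpha gamma a b th0).
Local Notation th := (iterates loss1 loss2 alg alpha gamma a b th0).
Local Notation g k := (G loss1 loss2 alg alpha gamma a b (pairs k).1 (pairs k).2).

Lemma iteratesS k :
  th k.+1 = ((th k).1 - alpha * g k ord0 ord0, (th k).2 - alpha * g k ord_max ord0).
Proof. by rewrite /iterates /= /topair !mxE. Qed.

Lemma iterates_invariant k : sq (th k).1 (th k).2 <= S /\
  sq ((pairs k).1.1 - (th k).1) ((pairs k).1.2 - (th k).2)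
    <= alpha ^+ 2 * (34 * (1 + S) ^+ 2) * sq (th k).1 (th k).2.
Proof.
elim: k => [|k [thS prevS]].
  (* The convention [theta_{-1} = theta_0] makes the initial displacement zero. *)
  split=> //; rewrite /iterates /= !subrr {1}/sq expr0n addr0 mulr_ge0 ?sq_ge0//.
  by apply: mulr_ge0; [exact: sqr_ge0 | have := sqr_ge0 (1 + S); lra].
have := perturbed_G alg S alpha gamma a b _ _ a0 b01 S64 thS al0 alS ga0 gaS prevS.
rewrite /perturbed => pert; rewrite iteratesS; split.
  exact: step_bounded pert _ _ S64 thS al0 alS.
have := step_displacement _ _ _ _ pert _ _ S64 thS al0 alS.
congr (sq _ _ <= _); rewrite -[(pairs k.+1).1]/(th k) ?opprB /=; ring.
Qed.

Lemma iterates_perturbed k : perturbed (th k) (g k).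
Proof.
have [thS prevS] := iterates_invariant k.
exact: (perturbed_G alg S alpha gamma a b _ _ a0 b01 S64 thS al0 alS ga0 gaS prevS).
Qed.

Lemma iterates_bounded : bounded_seq th.
Proof.
have sqrt_le (z w : R) : sq z w <= S -> `|z| <= S.
  by have S1 := S64; have := sqr_ge0 w; rewrite /sq ler_norml => w2 zw; nra.
exists S => k; have [thS _] := iterates_invariant k; split; first exact: sqrt_le thS.
by apply: (sqrt_le _ (th k).1); rewrite /sq addrC.
Qed.

Lemma iterates_neq0 k : 0 < sq (th k).1 (th k).2.
Proof.
elim: k => [|k IH].
  rewrite lt_neqAle sq_ge0 andbT eq_sym; apply/eqP => /sq_eq0[].
  move: th0_neq0; rewrite /iterates /=; case: th0 => x y /= xy0 x0 y0.
  by apply: xy0; rewrite x0 y0.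
have [thS _] := iterates_invariant k.
have := step_not_shrinking _ _ _ _ (iterates_perturbed k) _ _ S64 thS al0 alS.
by rewrite iteratesS /=; lra.
Qed.

Lemma iterates_divergent : ~ convergent_seq th.
Proof.
move=> [l thl]; have al2 : 0 < alpha ^+ 2 by rewrite exprn_gt0.
(* The increments tend to 0, and each has squared norm at least [alpha^2 / 20] times [sq] of the
   current iterate. *)
have small (e : R) : 0 < e -> exists N, forall k, (N <= k)%N ->
    sq (th k).1 (th k).2 < e.
  move=> e0; have e1 : 0 < alpha ^+ 2 * (e / 20) by rewrite mulr_gt0//; lra.
  have [N NP] := cvg_increments_small _ _ _ thl e1; exists N => k /NP.
  have := perturbed_field_lower _ _ _ _ (iterates_perturbed k).
  rewrite iteratesS /=; set h1 := g k _ _; set h2 := g k _ _.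
  have -> : sq ((th k).1 - alpha * h1 - (th k).1) ((th k).2 - alpha * h2 - (th k).2)
    = alpha ^+ 2 * sq h1 h2 by rewrite /sq; ring.
  by rewrite ltr_pM2l//; lra.
have [N NP] : exists N, forall k, (N <= k)%N -> sq (th k).1 (th k).2 < 1 / 3.
  by apply: small; lra.
have mono m : sq (th N).1 (th N).2 <= sq (th (N + m)%N).1 (th (N + m)%N).2.
  elim: m => [|m IH]; first by rewrite addn0.
  apply: (le_trans IH); rewrite addnS iteratesS /=.
  apply: (step_repelled _ _ _ _ (iterates_perturbed _)) => //.
  by rewrite ltW// NP// leq_addr.
(* The tolerance is the positive value of [sq] at step [N], below which [mono] forbids any later
   value. *)
have [M MP] := small _ (iterates_neq0 N).
have := MP (N + M)%N (leq_addl _ _); rewrite ltNge => /negP; exact.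
Qed.

End Dynamics.

Theorem theorem3 (R : realType) :
  exists L1 L2 : R -> R -> R,
    (forall x y, L1 x y = - L2 x y) /\
    analytic2 L1 /\ analytic2 L2 /\
    weakly_coercive L1 L2 /\
    nondegenerate_game L1 L2 /\
    (exists pbar, strict_max L1 L2 pbar /\
       forall p, critical L1 L2 p -> p = pbar) /\
    forall (alg : algo) (a b : R), 0 < a < 1 -> 0 < b < 1 ->
    forall P : probability (R * R)%type R,
      P `<< @leb2 R -> bounded_support P ->
      exists eps : R, 0 < eps /\
        forall alpha gamma : R, 0 < alpha < eps -> 0 < gamma < eps ->
          {ae P, forall th0 : R * R,
            bounded_nonconvergent (iterates L1 L2 alg alpha gamma a b th0)}.
Proof.
exists loss1, loss2; split; first by move=> x y; rewrite opprK.
split; first exact: analytic2_loss1.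
split; first exact: analytic2_loss2.
split; first exact: weakly_coercive_loss.
split; first exact: nondegenerate_loss.
split; first by exists (0, 0); split; [exact: strict_max_loss | exact: critical_loss].
move=> alg a b /andP[a0 _] b01 P Pleb Pbnd.
have [M aeM] := ae_bounded_nonzero P Pleb Pbnd.
(* The disc contains almost every initial point and is large enough for the one-step estimates;
   [K^-1] then bounds both [alpha] and [gamma]. *)
pose S := Num.max 64 M; pose K := 1000 * (1 + S) ^+ 2.
have S64 : 64 <= S by rewrite le_max lexx.
have D1 : 1 <= (1 + S) ^+ 2 by rewrite exprn_ege1//; lra.
have K0 : 0 < K by rewrite /K; lra.
exists K^-1; split; first by rewrite invr_gt0.
move=> alpha gamma /andP[al0 alK] /andP[ga0 gaK].
have rate t : t < K^-1 -> t * K < 1 by rewrite -lter_pdivlMr// div1r.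
apply: filterS aeM => th0 [th0M th0_neq0].
have th0S : sq th0.1 th0.2 <= S by rewrite le_max th0M orbT.
have [alS gaS] := (rate _ alK, rate _ gaK).
split; first exact: (iterates_bounded _ _ _ _ _ _ _ a0 b01 S64 al0 alS ga0 gaS th0S).
exact: (iterates_divergent _ _ _ _ _ _ _ a0 b01 S64 al0 alS ga0 gaS th0S th0_neq0).
Qed.
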